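(* There is an existential formula $\varphi(x)$ without parameters in the language $\mathcal{L}_{\rm ring}\cup\{P_2,P_3\}$ such that $\mathcal{O}_K=\varphi(K)$ holds for every Henselian valued field $K$ whose residue field $k$ is finite or pseudo-finite, provided that $k$ contains an element which is not a cube in case the characteristic of $k$ is $2$.
   Context: $\mathcal{L}_{\rm ring}=(+,-,\cdot,0,1)$ is the language of rings. For an integer $n>0$, $P_n$ is a unary predicate interpreted in a field as the set of nonzero $n$-th powers. A Henselian valued field $K$ has a nontrivial Henselian valuation with valuation ring $\mathcal{O}_K$ and residue field $k$. A pseudo-finite field is an infinite perfect pseudo-algebraically closed field with exactly one extension of each finite degree (equivalently, an infinite model of the theory of all finite fields). An existential formula is one of the form $\exists y_1\dots\exists y_n\,\psi$ with $\psi$ quantifier-free (possibly containing negated atomic formulas, including negated predicates). For a formula $\varphi(x)$ and a field $K$, $\varphi(K)$ denotes the set of $a\in K$ satisfying $\varphi$ in $K$. *)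

(* Defs.v *)
From HB Require Import structures.
From mathcomp Require Import all_boot all_order all_algebra all_field.
From mathcomp Require Import generic_quotient ring_quotient.
From mathcomp Require Import mpoly.

Set Implicit Arguments.
Unset Strict Implicit.
Unset Printing Implicit Defensive.

Import Order.TTheory GRing.Theory Num.Theory.
Local Open Scope ring_scope.

(* Variables are indexed by 'I_n; the only constants are 0 and 1, so formulas
   have no parameters. *)
Inductive term (n : nat) : Type :=
| Var of 'I_n
| Zero
| One
| Opp of term n
| Add of term n & term n
| Mul of term n & term n.

Inductive qf_formula (n : nat) : Type :=
| Eq of term n & term n
| P2 of term n
| P3 of term n
| Not of qf_formula n
| And of qf_formula n & qf_formula n
| Or of qf_formula n & qf_formula n.

(* The formula [exists y_1 ... y_n, psi (x, y_1, ..., y_n)] in the single free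
   variable x; variable [ord0] of psi is x, and variable [lift ord0 i] is the
   i-th bound variable. *)
Record ex_formula1 : Type := ExFormula1 {
  ex_bound : nat;
  ex_matrix : qf_formula ex_bound.+1
}.

Section Semantics.
Variable K : fieldType.

Definition nonzero_power (n : nat) (a : K) : Prop :=
  a != 0 /\ exists b : K, a = b ^+ n.

Fixpoint eval_term n (e : 'I_n -> K) (t : term n) : K :=
  match t with
  | Var i => e i
  | Zero => 0
  | One => 1
  | Opp t1 => - eval_term e t1
  | Add t1 t2 => eval_term e t1 + eval_term e t2
  | Mul t1 t2 => eval_term e t1 * eval_term e t2
  end.

Fixpoint holds_qf n (e : 'I_n -> K) (psi : qf_formula n) : Prop :=
  match psi with
  | Eq t1 t2 => eval_term e t1 = eval_term e t2
  | P2 t1 => nonzero_power 2 (eval_term e t1)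
  | P3 t1 => nonzero_power 3 (eval_term e t1)
  | Not psi1 => ~ holds_qf e psi1
  | And psi1 psi2 => holds_qf e psi1 /\ holds_qf e psi2
  | Or psi1 psi2 => holds_qf e psi1 \/ holds_qf e psi2
  end.

Definition env_cons n (x : K) (y : 'I_n -> K) (i : 'I_n.+1) : K :=
  if unlift ord0 i is Some j then y j else x.

Definition holds (phi : ex_formula1) (x : K) : Prop :=
  exists y : 'I_(ex_bound phi) -> K, holds_qf (env_cons x y) (ex_matrix phi).

End Semantics.

(* The value group is an arbitrary totally ordered abelian group, written
   additively.  The value of [vfun] at 0 is irrelevant: v(0) is +oo, which the
   definitions of the valuation ring and of its maximal ideal account for by
   treating 0 separately. *)
Record valuation (K : fieldType) : Type := Valuation {
  vgroup : porderZmodType;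
  vgroup_total : total (fun g h : vgroup => g <= h);
  vgroup_leD2r : forall g1 g2 h : vgroup, g1 <= g2 -> g1 + h <= g2 + h;
  vfun :> K -> vgroup;
  vfunM : forall x y : K, x != 0 -> y != 0 -> vfun (x * y) = vfun x + vfun y;
  vfunD : forall x y : K, x != 0 -> y != 0 -> x + y != 0 ->
    vfun x <= vfun (x + y) \/ vfun y <= vfun (x + y)
}.

Definition nontrivial_valuation (K : fieldType) (v : valuation K) : Prop :=
  exists2 x : K, x != 0 & v x != 0.

Section ValuationRing.
Variables (K : fieldType) (v : valuation K).

Definition val_ring : {pred K} := [pred x | (x == 0) || (0 <= v x)].

Lemma vfun1 : v 1 = 0.
Proof.
apply: (addrI (v 1)).
by rewrite addr0 -vfunM ?oner_neq0 // mulr1.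
Qed.

Lemma vgroup_double_eq0 (g : vgroup v) : g + g = 0 -> g = 0.
Proof.
move=> gg0; case/orP: (vgroup_total 0 g) => h; apply/eqP; rewrite eq_le h.
  by rewrite andbT; have := vgroup_leD2r g h; rewrite add0r gg0.
by rewrite /=; have := vgroup_leD2r g h; rewrite add0r gg0.
Qed.

Lemma vfunN x : v (- x) = v x.
Proof.
have [->|x0] := eqVneq x 0; first by rewrite oppr0.
have N1 : (-1 : K) != 0 by rewrite oppr_eq0 oner_neq0.
rewrite -mulN1r vfunM // [v (-1)]vgroup_double_eq0 ?add0r //.
by rewrite -vfunM // mulrNN mulr1 vfun1.
Qed.

Lemma vfunV x : x != 0 -> v x^-1 = - v x.
Proof.
move=> x0; apply: (addrI (v x)).
by rewrite -vfunM ?invr_eq0 // divff // vfun1 subrr.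
Qed.

Lemma vgroup_addr_ge0 (g h : vgroup v) : 0 <= g -> 0 <= h -> 0 <= g + h.
Proof.
by move=> g0 h0; apply: le_trans h0 _; have := vgroup_leD2r h g0; rewrite add0r.
Qed.

Lemma val_ring_subring : subring_closed val_ring.
Proof.
split=> [|x y|x y]; rewrite !inE.
- by rewrite vfun1 lexx orbT.
- move=> Ox Oy; have [//|xy0] := eqVneq (x - y) 0.
  have [x0|x0] := eqVneq x 0; first by move: Oy xy0; rewrite x0 sub0r oppr_eq0 vfunN; case: eqP.
  have [y0|y0] := eqVneq y 0; first by move: Ox; rewrite y0 subr0 (negPf x0).
  move: Ox Oy; rewrite (negPf x0) (negPf y0) /= => vx vy.
  have := @vfunD _ v x (- y) x0; rewrite oppr_eq0 vfunN => /(_ y0 xy0) [].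
    exact: le_trans.
  exact: le_trans.
- have [->|x0] := eqVneq x 0; first by rewrite mul0r eqxx.
  have [->|y0] := eqVneq y 0; first by rewrite mulr0 eqxx.
  by rewrite /= vfunM // => vx vy; rewrite vgroup_addr_ge0 ?orbT.
Qed.

HB.instance Definition _ := GRing.isSubringClosed.Build K val_ring val_ring_subring.

Record val_ring_type : Type := ValRing {
  val_ring_val :> K;
  _ : val_ring_val \in val_ring
}.

HB.instance Definition _ := [isSub for val_ring_val].
HB.instance Definition _ := [Choice of val_ring_type by <:].
HB.instance Definition _ := [SubChoice_isSubComNzRing of val_ring_type by <:].

Definition max_ideal : {pred val_ring_type} :=
  [pred x : val_ring_type | (val x == 0) || (0 < v (val x))].

Lemma max_idealE (x : val_ring_type) :
  (x \in max_ideal) = (val x == 0) || (v (val x) != 0).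
Proof.
have := valP x; rewrite !inE; case: eqP => //= _ vx.
by rewrite lt_def vx andbT.
Qed.

Lemma max_idealVP (x : val_ring_type) :
  x \notin max_ideal -> (val x)^-1 \in val_ring.
Proof.
rewrite max_idealE negb_or negbK => /andP[x0 /eqP vx].
by rewrite inE vfunV // vx oppr0 lexx orbT.
Qed.

Lemma max_ideal_unitP (x : val_ring_type) :
  reflect (exists y : val_ring_type, x * y = 1) (x \notin max_ideal).
Proof.
apply: (iffP idP) => [xM|[y]].
  exists (ValRing (max_idealVP xM)); apply: val_inj; rewrite /= divff //.
  by move: xM; rewrite max_idealE negb_or => /andP[].
move=> /(congr1 val); rewrite rmorphM rmorph1 => xy.
have x0 : val x != 0.
  by apply/eqP => x0; move/eqP: xy; rewrite [X in X * _]x0 mul0r eq_sym oner_eq0.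
have y0 : val y != 0.
  by apply/eqP => y0; move/eqP: xy; rewrite [X in _ * X]y0 mulr0 eq_sym oner_eq0.
have vy : 0 <= v (val y) by case/orP: (valP y) => // /eqP vE; case/eqP: y0.
have vx : 0 <= v (val x) by case/orP: (valP x) => // /eqP vE; case/eqP: x0.
have vxy : v (val x) + v (val y) = 0 by rewrite -vfunM // xy vfun1.
rewrite max_idealE (negPf x0) negbK eq_le vx andbT -vxy.
by have := vgroup_leD2r (v (val x)) vy; rewrite add0r addrC.
Qed.

Lemma max_ideal_closed : idealr_closed max_ideal.
Proof.
have MM (a u : val_ring_type) : u \in max_ideal -> a * u \in max_ideal.
  apply: contraLR => /max_ideal_unitP[y auy]; apply/max_ideal_unitP.
  by exists (a * y); rewrite mulrCA mulrA.
split=> [||a x y xM yM]; first by rewrite inE raddf0 eqxx.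
  by apply/max_ideal_unitP; exists 1; rewrite mulr1.
have {}xM := MM a _ xM; move: (a * x) xM => {a x}x.
move: yM; rewrite !inE raddfD /=.
have [->|x0] := eqVneq (val x) 0; first by rewrite add0r.
have [->|y0] := eqVneq (val y) 0; first by rewrite addr0 (negPf x0).
have [//|xy0] := eqVneq (val x + val y) 0; rewrite /= => vy vx.
by have [] := vfunD v x0 y0 xy0; [exact: lt_le_trans vx | exact: lt_le_trans vy].
Qed.

HB.instance Definition _ :=
  isIdealr.Build val_ring_type max_ideal max_ideal_closed.

Definition residue_field : Type := {ideal_quot max_ideal}.

HB.instance Definition _ := GRing.ComNzRing.on residue_field.

Definition residue (x : val_ring_type) : residue_field :=
  \pi_({ideal_quot max_ideal})%qT x.

HB.instance Definition _ := GRing.RMorphism.copy residue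
  (\pi_({ideal_quot max_ideal})%qT : val_ring_type -> {ideal_quot max_ideal}).

Lemma residue_eq0 x : (residue x == 0) = (x \in max_ideal).
Proof.
by rewrite -[x in RHS]subr0 Quotient.idealrBE -[X in _ == X](rmorph0 residue).
Qed.

Definition residue_inv (a : residue_field) : residue_field :=
  if a == 0 then 0 else residue (insubd 0 (val (generic_quotient.repr a))^-1).

Lemma residue_inv0 : residue_inv 0 = 0.
Proof. by rewrite /residue_inv eqxx. Qed.

Lemma residue_mulV a : a != 0 -> residue_inv a * a = 1.
Proof.
move=> a0; rewrite /residue_inv (negPf a0).
have aE : a = residue (generic_quotient.repr a) by rewrite /residue reprK.
set x := generic_quotient.repr a in aE *; rewrite aE residue_eq0 in a0.
rewrite aE -rmorphM -[RHS](rmorph1 residue); congr residue.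
have -> : insubd 0 (val x)^-1 = ValRing (max_idealVP a0).
  by apply: val_inj; rewrite insubdK ?max_idealVP.
apply: val_inj; rewrite /= mulVf //.
by move: a0; rewrite max_idealE negb_or => /andP[].
Qed.

HB.instance Definition _ :=
  GRing.ComNzRing_isField.Build residue_field residue_mulV residue_inv0.

End ValuationRing.

Arguments max_ideal {K} v _.

(* Hensel's lemma holds: a zero of f modulo the maximal ideal at which f' does
   not vanish modulo the maximal ideal lifts to a zero of f. *)
Definition henselian (K : fieldType) (v : valuation K) : Prop :=
  forall (f : {poly val_ring_type v}) (a : val_ring_type v),
    f.[a] \in max_ideal v -> f^`().[a] \notin max_ideal v ->
    exists2 b : val_ring_type v, f.[b] = 0 & b - a \in max_ideal v.

Definition finite_field (k : fieldType) : Prop :=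
  exists s : seq k, forall x : k, x \in s.

Definition perfect_field (k : fieldType) : Prop :=
  forall p : nat, p \in [pchar k] -> forall x : k, exists y : k, y ^+ p = x.

Definition algebraic_closure (k L : fieldType) (iota : {rmorphism k -> L}) :=
  GRing.closed_field_axiom L /\ forall z : L, algebraicOver iota z.

Definition ideal_gen (R : comNzRingType) (m : nat) (f : 'I_m -> R) (p : R) :=
  exists c : 'I_m -> R, p = \sum_(i < m) c i * f i.

Definition is_prime_ideal (R : comNzRingType) (I : R -> Prop) : Prop :=
  ~ I 1 /\ forall p q : R, I (p * q) -> I p \/ I q.

(* The affine k-variety defined by f_1 = ... = f_m = 0 is absolutely
   irreducible (geometrically integral): the f_i generate a prime ideal over
   the algebraic closure of k. *)
Definition absolutely_irreducible (k : fieldType) (n m : nat)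
    (f : 'I_m -> {mpoly k[n]}) : Prop :=
  forall (L : fieldType) (iota : {rmorphism k -> L}),
    algebraic_closure iota ->
    is_prime_ideal (ideal_gen (fun i => map_mpoly iota (f i))).

(* Every absolutely irreducible variety over k has a k-rational point; affine
   varieties suffice, as every variety has a nonempty affine open subvariety. *)
Definition pac_field (k : fieldType) : Prop :=
  forall (n m : nat) (f : 'I_m -> {mpoly k[n]}),
    absolutely_irreducible f ->
    exists a : 'I_n -> k, forall i : 'I_m, (f i).@[a] = 0.

(* Exactly one extension of degree n inside an algebraic closure of k.  Any two
   finite extensions inside the algebraic closure lie in a common finite
   extension M, so uniqueness is stated for the subfields of such an M. *)
Definition unique_extension_of_degree (k : fieldType) (n : nat) : Prop :=
  (exists L : fieldExtType k, \dim {:L} = n) /\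
  (forall (M : fieldExtType k) (E F : {subfield M}),
     \dim E = n -> \dim F = n -> E = F).

Definition pseudo_finite_field (k : fieldType) : Prop :=
  [/\ ~ finite_field k, perfect_field k, pac_field k &
      forall n : nat, (0 < n)%N -> unique_extension_of_degree k n].

(* Main.v *)
(* For n in {2, 3} let A_n be the set of y such that y^(n-1) (y + 1) is not a
   nonzero n-th power; for y <> 0 this says that 1 + 1/y is not one.  By Hensel
   1 + n^2 M consists of n-th powers, so n^2 A_n lies in O: when n is a unit of O
   this gives A_n <= O, and when n lies in M it makes 1 + n^7 g an n-th power for
   every g in A_n A_n + A_n A_n.  The formula says, for n = 2 or n = 3, that x
   lies in A_n A_n + A_n A_n and that some such g has 1 + n^7 g not an n-th
   power; the latter excludes the residue characteristic n.
   Conversely suppose that n is nonzero in k and that u in k is not an n-th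
   power.  Elements of O with residue 1/(w - 1), w not an n-th power, lie in A_n,
   so it suffices to solve (u s^n - 1)(u t^n - 1) = c in k for c <> 0.  In a
   finite field pigeonhole does it.  In a pseudo-finite field the PAC property
   does: with T = t (u s^n - 1) the curve becomes
   T^n = u^-1 (u s^n - 1)^(n-1) (u s^n - 1 + c), whose right-hand side vanishes to
   order n - 1, prime to n, at the roots of u s^n = 1; hence it is absolutely
   irreducible. *)
From HB Require Import structures.
Require Import Defs.
From mathcomp Require Import all_boot all_order all_algebra all_field.
From mathcomp Require Import generic_quotient fraction.
From mathcomp Require Import mpoly ring.
From Stdlib Require Import Classical.

Set Implicit Arguments.
Unset Strict Implicit.
Unset Printing Implicit Defensive.

Import Order.TTheory GRing.Theory.
Local Open Scope ring_scope.

(** * Nonpowers of a field and the products built from them *)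

Section Powers.
Variables (k : fieldType) (n : nat).
Implicit Types a b u w z : k.

Definition nth_power a := exists b : k, a = b ^+ n.

(** The elements [1/(w - 1)] for nonpowers [w], that is, [1 + 1/b] is not a power; the product form
    forces [b] to be nonzero. *)
Definition moebius_nonpower b := exists w, ~ nth_power w /\ b * (w - 1) = 1.

(** The value [-1] is [1/(w - 1)] at [w = 0]. It is allowed in one factor only: it will be lifted to
    [-1] itself, whereas the other factor will be lifted as a quotient. *)
Definition good_product z := exists b1 b2,
  [/\ z = b1 * b2, moebius_nonpower b1 & moebius_nonpower b2 \/ b2 = -1].

End Powers.

(** * Multiplicities and irreducibility over fraction fields *)

Local Notation "x %:F" := (@FracField.tofrac _ x) : ring_scope.

Lemma fractionP (R : idomainType) (r : {fraction R}) :
  exists a b : R, b != 0 /\ r * b%:F = a%:F.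
Proof.
elim/quotW: r => x; exists \n_x, \d_x; split; first exact: denom_ratioP.
unlock FracField.tofrac; rewrite -[LHS]FracField.pi_mul; apply/eqmodP => /=.
rewrite FracField.equivfE /FracField.mulf.
by rewrite !numden_Ratio ?oner_neq0 ?mulr1 ?denom_ratioP // mulrC.
Qed.

Lemma mupX (L : fieldType) (x : L) (p : {poly L}) n :
  p != 0 -> mup x (p ^+ n) = (n * mup x p)%N.
Proof.
move=> p0; elim: n => [|n IHn]; last by rewrite exprS mupM ?expf_neq0 // IHn mulSn.
by rewrite expr0 mupNroot // /root hornerC oner_eq0.
Qed.

Lemma mup_simple_root (L : fieldType) (x : L) (p : {poly L}) :
  root p x -> ~~ root p^`() x -> mup x p = 1%N.
Proof.
move=> px p'x; have p0 : p != 0 by apply: contraNneq p'x => ->; rewrite deriv0 root0.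
apply/eqP; rewrite eqn_leq -XsubC_dvd // dvdp_XsubCl px andbT mup_leq //.
apply: contra p'x => /dvdpP[q ->].
by rewrite /root expr2 mulrA derivM derivXsubC !hornerE subrr !mulr0 addr0.
Qed.

(** Writing [r = a/b] and comparing multiplicities at [x] in [a^n = g b^n] would make [n] divide
    that of [g]. *)
Lemma fraction_expr_neq (L : fieldType) (n : nat) (g : {poly L}) (x : L) :
  g != 0 -> ~~ (n %| mup x g)%N ->
  forall r : {fraction {poly L}}, r ^+ n != g%:F.
Proof.
move=> g0 ndv r; apply: contra ndv => /eqP rn.
have [n0|n0] := posnP n.
  move: rn; rewrite n0 expr0 -tofrac1 => /eqP; rewrite tofrac_eq => /eqP <-.
  by rewrite -(expr0 (1 : {poly L})) mupX ?oner_neq0.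
have [a [b [b0 rE]]] := fractionP r.
have ab : a ^+ n = g * b ^+ n.
  by apply/eqP; rewrite -tofrac_eq rmorphM !rmorphXn /= -rn -rE exprMn.
have a0 : a != 0.
  apply: contraNneq b0 => a0; move/eqP: ab; rewrite a0 expr0n (gtn_eqF n0) eq_sym.
  by rewrite mulf_eq0 (negPf g0) expf_eq0 n0.
move/(congr1 (mup x)): ab; rewrite mupX // mupM ?expf_neq0 // mupX // => E.
by rewrite -(dvdn_addl _ (dvdn_mulr (mup x b) (dvdnn n))) -E dvdn_mulr.
Qed.

(** As [f] is monic, one can divide with remainder over [R]; the remainder keeps its smaller degree
    over the fraction field, so it vanishes. *)
Lemma monic_fraction_dvd (R : idomainType) (f p : {poly R}) : f \is monic ->
  map_poly (@FracField.tofrac R) f %| map_poly (@FracField.tofrac R) p ->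
  exists d, p = d * f.
Proof.
move=> fm fp; have f0 := monic_neq0 fm.
pose d := Pdiv.Ring.rdivp p f; pose r := Pdiv.Ring.rmodp p f.
have pE : p = d * f + r by exact: Pdiv.RingMonic.rdivp_eq.
have tof_inj : injective (@FracField.tofrac R).
  by move=> a b /eqP; rewrite tofrac_eq => /eqP.
have szE q : size (map_poly (@FracField.tofrac R) q) = size q.
  by rewrite size_map_inj_poly ?rmorph0.
exists d; rewrite pE [r](_ : _ = 0) ?addr0 //.
apply: contraTeq fp => r0; rewrite pE rmorphD rmorphM /= dvdp_addr ?dvdp_mull //.
apply: contraL (Pdiv.Ring.ltn_rmodpN0 p f0) => fr; rewrite -leqNgt.
by rewrite -(szE f) -(szE r) dvdp_leq // -size_poly_gt0 szE size_poly_gt0.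
Qed.

Lemma monic_fraction_prime (R : idomainType) (f p q d : {poly R}) :
  f \is monic -> irreducible_poly (map_poly (@FracField.tofrac R) f) ->
  p * q = d * f -> (exists e, p = e * f) \/ (exists e, q = e * f).
Proof.
move=> fm irr pq; pose F := map_poly (@FracField.tofrac R).
have dv : F f %| F p * F q by rewrite -rmorphM pq rmorphM dvdp_mull.
have [fp|nfp] := boolP (F f %| F p); first by left; exact: monic_fraction_dvd.
right; apply: monic_fraction_dvd => //.
by move: dv; rewrite Gauss_dvdpr // irreducible_poly_coprime.
Qed.

(* Irreducibility over the fraction field only needs the absence of roots in
   degree at most 3, which the multiplicity condition provides. *)
Lemma XnsubC_prime (L : fieldType) (n : nat) (g : {poly L}) (x : L)
    (p q d : {poly {poly L}}) :
  (1 < n <= 3)%N -> g != 0 -> ~~ (n %| mup x g)%N ->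
  p * q = d * ('X^n - g%:P) ->
  (exists e, p = e * ('X^n - g%:P)) \/ (exists e, q = e * ('X^n - g%:P)).
Proof.
move=> /andP[n1 n3] g0 gx; have n0 := ltnW n1.
apply: monic_fraction_prime; first exact: monicXnsubC.
rewrite rmorphB /= map_polyXn map_polyC /=.
apply: cubic_irreducible => [|r]; first by rewrite size_XnsubC // ltnS n0 ltnS.
by rewrite /root !hornerE subr_eq0 (fraction_expr_neq g0 gx).
Qed.

(** * Plane curves [T^n = g(s)] as polynomials in [T] over [L[s]] *)

Section TwoVariables.
Variable L : fieldType.

Definition bipoly_var (i : 'I_2) : {poly {poly L}} :=
  if i == ord0 then 'X%:P else 'X.

Definition bipoly_of_mpoly : {mpoly L[2]} -> {poly {poly L}} :=
  mmap (polyC \o polyC) bipoly_var.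

HB.instance Definition _ := GRing.RMorphism.on bipoly_of_mpoly.

Definition mpoly_of_bipoly : {poly {poly L}} -> {mpoly L[2]} :=
  horner_eval 'X_ord_max \o
  map_poly (horner_eval 'X_ord0 \o map_poly (@mpolyC 2 L)).

HB.instance Definition _ := GRing.RMorphism.on mpoly_of_bipoly.

Lemma mpoly_of_bipolyC (p : {poly L}) :
  mpoly_of_bipoly p%:P = (map_poly (@mpolyC 2 L) p).['X_ord0].
Proof. by rewrite /mpoly_of_bipoly /= map_polyC /horner_eval hornerC. Qed.

Lemma mpoly_of_bipolyX : mpoly_of_bipoly 'X = 'X_ord_max.
Proof. by rewrite /mpoly_of_bipoly /= map_polyX /horner_eval hornerX. Qed.

Lemma bipoly_of_mpolyK : cancel bipoly_of_mpoly mpoly_of_bipoly.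
Proof.
elim/mpolyind => [|c m p _ _ IHp]; first by rewrite !rmorph0.
rewrite (rmorphD bipoly_of_mpoly) (rmorphD mpoly_of_bipoly) [X in _ + X]IHp.
congr (_ + _).
transitivity (mpoly_of_bipoly (bipoly_of_mpoly (c *: 'X_[m]))) => [//|].
rewrite [bipoly_of_mpoly _]mmapZ mmapX /mmap1 (rmorphM mpoly_of_bipoly).
rewrite [X in X * _]mpoly_of_bipolyC map_polyC hornerC.
rewrite (rmorph_prod mpoly_of_bipoly) -mul_mpolyC; congr (_ * _).
rewrite [RHS]mpolyXE_id; apply: eq_bigr => i _.
transitivity (mpoly_of_bipoly (bipoly_var i) ^+ m i); first exact: rmorphXn.
congr (_ ^+ _); rewrite /bipoly_var.
case: ifP => [/eqP -> | i0]; first by rewrite mpoly_of_bipolyC map_polyX hornerX.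
by rewrite mpoly_of_bipolyX; congr 'X_ _; apply: val_inj; case: i i0 => -[|[|]].
Qed.

Definition curve_mpoly n (g : {poly L}) : {mpoly L[2]} :=
  'X_ord_max ^+ n - (map_poly (@mpolyC 2 L) g).['X_ord0].

Lemma curve_mpolyE n g : curve_mpoly n g = mpoly_of_bipoly ('X^n - g%:P).
Proof.
rewrite (rmorphB mpoly_of_bipoly) [X in _ - X]mpoly_of_bipolyC; congr (_ - _).
by rewrite -mpoly_of_bipolyX; apply/esym; exact: rmorphXn.
Qed.

Lemma bipoly_of_mpolyX : bipoly_of_mpoly 'X_ord_max = 'X.
Proof. by rewrite /bipoly_of_mpoly mmapX mmap1U. Qed.

Lemma mpoly_of_bipolyK : cancel mpoly_of_bipoly bipoly_of_mpoly.
Proof.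
have FD P Q : bipoly_of_mpoly (mpoly_of_bipoly (P + Q)) =
    bipoly_of_mpoly (mpoly_of_bipoly P) + bipoly_of_mpoly (mpoly_of_bipoly Q).
  by rewrite (rmorphD mpoly_of_bipoly) (rmorphD bipoly_of_mpoly).
have FM P Q : bipoly_of_mpoly (mpoly_of_bipoly (P * Q)) =
    bipoly_of_mpoly (mpoly_of_bipoly P) * bipoly_of_mpoly (mpoly_of_bipoly Q).
  by rewrite (rmorphM mpoly_of_bipoly) (rmorphM bipoly_of_mpoly).
elim/poly_ind => [|P c IHP].
  by rewrite (rmorph0 mpoly_of_bipoly) (rmorph0 bipoly_of_mpoly).
rewrite FD FM IHP mpoly_of_bipolyX bipoly_of_mpolyX; congr (_ + _).
elim/poly_ind: c => [|p c IHc].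
  by rewrite (rmorph0 mpoly_of_bipoly) (rmorph0 bipoly_of_mpoly).
rewrite polyCD polyCM FD FM IHc; congr (_ * _ + _); rewrite mpoly_of_bipolyC.
  by rewrite map_polyX hornerX /bipoly_of_mpoly mmapX mmap1U.
by rewrite map_polyC hornerC /bipoly_of_mpoly mmapC.
Qed.

(** Primality is transported along two mutually inverse ring morphisms; [1] is no multiple of the
    equation, whose degree in [T] is [n > 0]. *)
Lemma curve_mpoly_prime n (g : {poly L}) (x : L) :
  (1 < n <= 3)%N -> g != 0 -> ~~ (n %| mup x g)%N ->
  forall h : 'I_1 -> {mpoly L[2]}, h ord0 = curve_mpoly n g ->
  is_prime_ideal (ideal_gen h).
Proof.
move=> n3 g0 gx h hE; set f := 'X^n - g%:P.
have toF p c : p = c * curve_mpoly n g -> bipoly_of_mpoly p = bipoly_of_mpoly c * f.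
  move=> ->; rewrite curve_mpolyE (rmorphM bipoly_of_mpoly).
  by rewrite [X in _ * X]mpoly_of_bipolyK.
split=> [[c]|p q [c]]; rewrite big_ord1 hE => /toF; last first.
  have dvd r : (exists e, bipoly_of_mpoly r = e * f) ->
      ideal_gen h r.
    case=> e re; exists (fun _ => mpoly_of_bipoly e); rewrite big_ord1 hE.
    by rewrite -[LHS]bipoly_of_mpolyK re curve_mpolyE; exact: rmorphM.
  rewrite (rmorphM bipoly_of_mpoly).
  by case/(XnsubC_prime n3 g0 gx) => /dvd; [left | right].
rewrite (rmorph1 bipoly_of_mpoly) => /(congr1 (fun P : {poly {poly L}} => size P == 1)).
have n0 : (0 < n)%N by case/andP: n3 => /ltnW.
rewrite size_poly1 eqxx size_mul_eq1 size_XnsubC // eqSS (gtn_eqF n0).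
by rewrite andbF.
Qed.

End TwoVariables.

Lemma map_curve_mpoly (k L : fieldType) (iota : {rmorphism k -> L}) n
    (g : {poly k}) :
  map_mpoly iota (curve_mpoly n g) = curve_mpoly n (map_poly iota g).
Proof.
rewrite /curve_mpoly rmorphB rmorphXn /= -horner_map /= !map_mpolyX -!map_poly_comp.
congr (_ - _.[_]); apply: eq_map_poly => a /=; exact: map_mpolyC.
Qed.

Lemma meval_curve_mpoly (k : fieldType) n (g : {poly k}) (a : 'I_2 -> k) :
  (curve_mpoly n g).@[a] = a ord_max ^+ n - g.[a ord0].
Proof.
rewrite /curve_mpoly rmorphB rmorphXn /= -horner_map /= !mevalXU -map_poly_comp.
by congr (_ - _.[_]); rewrite map_poly_id // => c _ /=; rewrite mevalC.
Qed.

(** * Absolutely irreducible curves and products in PAC fields *)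

Definition nonpower_curve (k : fieldType) (n : nat) (u c : k) : {poly k} :=
  u^-1 *: ((u *: 'X^n - 1) ^+ n.-1 * (u *: 'X^n - 1 + c%:P)).

Lemma nonpower_curve_abs_irr (k : fieldType) n (u c : k) :
  (1 < n <= 3)%N -> n%:R != 0 :> k -> u != 0 -> c != 0 ->
  absolutely_irreducible (fun _ : 'I_1 => curve_mpoly n (nonpower_curve n u c)).
Proof.
move=> n3 nk u0 c0 L iota [closL _]; have /andP[n1 _] := n3; have n0 := ltnW n1.
pose u' := iota u; pose c' := iota c.
have u'0 : u' != 0 by rewrite fmorph_eq0.
have c'0 : c' != 0 by rewrite fmorph_eq0.
have [z zn] : exists z : L, z ^+ n = u'^-1.
  (* [closL] solves [z^n = sum_i P_i z^i]; only the constant coefficient is taken nonzero. *)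
  have [z zE] := closL n (fun i => if i == 0%N then u'^-1 else 0) n0.
  exists z; rewrite zE; case: (n) n0 => // m _.
  by rewrite big_ord_recl /= expr0 mulr1 big1 ?addr0 // => i _; rewrite mul0r.
have z0 : z != 0.
  by apply: contraNneq u'0 => z0; rewrite -invr_eq0 -zn z0 expr0n gtn_eqF.
pose h := u' *: 'X^n - 1.
have hz : root h z by rewrite /root !hornerE zn mulfV ?subrr.
(* The derivative at [z] is [n u' z^(n-1)], nonzero since [n] is nonzero in [k]; so [h ^+ n.-1] has
   multiplicity exactly [n - 1]. *)
have h'z : ~~ root h^`() z.
  rewrite /root derivB derivZ derivXn derivC subr0 !hornerE hornerMn hornerXn.
  rewrite -mulr_natl !mulf_neq0 ?expf_neq0 //.
  by rewrite -(rmorph_nat iota) fmorph_eq0.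
have hc : ~~ root (h + c'%:P) z.
  by rewrite rootE hornerD hornerC (rootP hz) add0r.
have h0 : h != 0 by apply: contraNneq h'z => ->; rewrite deriv0 root0.
have hc0 : h + c'%:P != 0 by apply: contraNneq hc => ->; rewrite root0.
have gE : map_poly iota (nonpower_curve n u c) = u'^-1%:P * (h ^+ n.-1 * (h + c'%:P)).
  rewrite /nonpower_curve map_polyZ rmorphM rmorphXn !rmorphD rmorphN rmorph1 /=.
  by rewrite map_polyZ map_polyXn map_polyC /= fmorphV mul_polyC.
apply: (@curve_mpoly_prime L n (map_poly iota (nonpower_curve n u c)) z) => //.
- by rewrite gE !mulf_neq0 ?expf_neq0 // polyC_eq0 invr_eq0.
- rewrite gE mupMr ?mupMl ?mupX ?(mup_simple_root hz h'z) ?muln1 //; last first.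
    by rewrite rootE hornerC invr_eq0.
  by rewrite gtnNdvd ?prednK // -ltnS prednK.
- exact: map_curve_mpoly.
Qed.

Lemma pac_product (k : fieldType) n (u c : k) : pac_field k ->
  (1 < n <= 3)%N -> n%:R != 0 :> k -> ~ nth_power n u -> c != 0 ->
  exists s t : k, (u * s ^+ n - 1) * (u * t ^+ n - 1) = c.
Proof.
move=> pac n3 nk nu c0; have /andP[n1 _] := n3; have n0 := ltnW n1.
have u0 : u != 0 by apply/eqP => u0; case: nu; exists 0; rewrite u0 expr0n gtn_eqF.
have [a /(_ ord0)] := pac _ _ _ (nonpower_curve_abs_irr n3 nk u0 c0).
rewrite meval_curve_mpoly => /eqP; rewrite subr_eq0 => /eqP.
move: (a ord_max) (a ord0) => t s; rewrite /nonpower_curve !hornerE.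
set d := u * s ^+ n - 1 => tn.
have d0 : d != 0.
  (* A zero of [d] would make [u] the [n]-th power of [s^-1]. *)
  apply/eqP => /eqP; rewrite subr_eq0 => /eqP us; case: nu; exists s^-1.
  have sn0 : s ^+ n != 0.
    by apply: contraTneq (oner_neq0 k) => sn; rewrite -us sn mulr0 eqxx.
  by rewrite exprVn; apply: (mulIf sn0); rewrite us mulVf.
have dn : d ^+ n = d * d ^+ n.-1 by rewrite -exprS prednK.
(* Here [t] is the ordinate [T] of the curve; dividing by [d] undoes the substitution. *)
exists s, (t / d); rewrite -/d expr_div_n tn dn.
have := expf_neq0 n.-1 d0; move: (d ^+ n.-1) => e e0.
by move: d d0 {tn dn} => d d0 /=; field; rewrite d0 u0 e0.
Qed.

Lemma nth_powerMX (k : fieldType) n (a b : k) : b != 0 ->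
  nth_power n (a * b ^+ n) -> nth_power n a.
Proof.
move=> b0 [c e]; exists (c / b).
by rewrite expr_div_n -e mulfK // expf_neq0.
Qed.

Lemma pac_good_product (k : fieldType) n (u z : k) : pac_field k ->
  (1 < n <= 3)%N -> n%:R != 0 :> k -> ~ nth_power n u -> z != 0 -> z != 1 ->
  good_product n z.
Proof.
move=> pac n3 nk nu z0 z1; have /andP[n1 _] := n3; have n0 := ltnW n1.
have [|s [t st]] := pac_product pac n3 nk nu (c := z^-1); first by rewrite invr_eq0.
have mb (r : k) : r != 0 -> u * r ^+ n - 1 != 0 ->
    moebius_nonpower n (u * r ^+ n - 1)^-1.
  move=> r0 d0; exists (u * r ^+ n); split; last by rewrite mulVf.
  by move/(nth_powerMX r0).
have st0 : (u * s ^+ n - 1) * (u * t ^+ n - 1) != 0 by rewrite st invr_eq0.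
have /norP[ds0 dt0] : ~~ ((u * s ^+ n - 1 == 0) || (u * t ^+ n - 1 == 0)).
  by rewrite -mulf_eq0.
have zE : z = (u * s ^+ n - 1)^-1 * (u * t ^+ n - 1)^-1 by rewrite -invfM st invrK.
have mt : t != 0 -> moebius_nonpower n (u * t ^+ n - 1)^-1 by move/mb; apply.
have N1 : (u * 0 ^+ n - 1)^-1 = -1 by rewrite expr0n gtn_eqF // mulr0 sub0r invrN1.
(* A zero coordinate gives the factor [-1], to be placed second; two zero coordinates would give
   [z = 1]. *)
have [s0|s0] := eqVneq s 0.
  have t0 : t != 0.
    by apply: contraNneq z1 => t0; rewrite zE s0 t0 !N1 mulrNN mulr1.
  exists (u * t ^+ n - 1)^-1, (u * s ^+ n - 1)^-1; split; first by rewrite mulrC.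
    exact: mt.
  by right; rewrite s0.
exists (u * s ^+ n - 1)^-1, (u * t ^+ n - 1)^-1; split=> //; first exact: mb.
by have [->|/mt] := eqVneq t 0; [right | left].
Qed.

(** * Products in finite fields, and sums of two products *)

Lemma finite_good_product (k : fieldType) n (u z : k) : finite_field k ->
  (0 < n)%N -> ~ nth_power n u -> z != 0 -> good_product n z.
Proof.
move=> [s0 s0P] n0 nu z0; pose s := undup s0.
have sP x : x \in s by rewrite mem_undup.
have u0 : u != 0 by apply/eqP => u0; case: nu; exists 0; rewrite u0 expr0n gtn_eqF.
pose pw (w : k) := has (fun b => w == b ^+ n) s.
have pwP w : reflect (nth_power n w) (pw w).
  by apply: (iffP hasP) => [[b _ /eqP ->] | [b ->]]; exists b.
pose s' := rem 0 s.
have s'P x : (x \in s') = (x != 0) by rewrite mem_rem_uniq ?undup_uniq // inE sP andbT.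
have s'u : uniq s' by rewrite rem_uniq ?undup_uniq.
pose N := filter (predC pw) s'; pose P := filter pw s'.
have sizeNP : (size N + size P = size s')%N.
  by rewrite addnC !size_filter count_predC.
(* Multiplication by [u] injects the nonzero powers into the nonzero nonpowers. *)
have leP : (size P <= size N)%N.
  rewrite -(size_map ( *%R u)) uniq_leq_size //.
    by rewrite map_inj_uniq ?filter_uniq //; exact: mulfI.
  move=> y /mapP[w]; rewrite mem_filter => /andP[/pwP[b wb]]; rewrite s'P => w0 ->.
  rewrite mem_filter s'P mulf_neq0 // andbT /=; apply/pwP; rewrite wb.
  move/nth_powerMX => h; case: nu; apply: h.
  by apply: contraNneq w0; rewrite wb => ->; rewrite expr0n gtn_eqF.
have inv_inj : {in N &, injective (fun w : k => (w - 1)^-1)}.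
  by move=> x y _ _ /invr_inj /addIr.
have N1 w : w \in N -> w - 1 != 0.
  rewrite mem_filter subr_eq0 /= => /andP[wN _]; apply: contraNneq wN => ->.
  by apply/pwP; exists 1; rewrite expr1n.
pose B := [seq (w - 1)^-1 | w <- N].
have Bu : uniq B by rewrite map_inj_in_uniq ?filter_uniq.
have BP b : b \in B -> b != 0 /\ moebius_nonpower n b.
  move=> /mapP[w wN ->]; rewrite invr_eq0 N1 //; split=> //.
  exists w; split; last by rewrite mulVf ?N1.
  by move: wN; rewrite mem_filter => /andP[/pwP].
have BN1 : -1 \notin B.
  apply/mapP => -[w wN] /(congr1 (fun x => x^-1)); rewrite invrK invrN1.
  move=> /eqP; rewrite eq_sym subr_eq addNr => /eqP w0.
  by move: wN; rewrite w0 mem_filter s'P eqxx andbF.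
pose C := [seq z / b | b <- -1 :: B].
have Cu : uniq C.
  rewrite map_inj_uniq /= ?BN1 // => x y /(mulfI z0); exact: invr_inj.
(* Pigeonhole: if disjoint, [C] and [B] would give [2|N| + 1] nonzero elements, but there are only
   [|N| + |P|]. *)
have [b bB bC] : exists2 b, b \in B & b \in C.
  apply/hasP; rewrite -[has _ _]negbK; apply/negP => nh.
  have CBu : uniq (C ++ B) by rewrite cat_uniq Cu Bu andbT.
  have CBs : {subset C ++ B <= s'}.
    move=> x; rewrite mem_cat s'P => /orP[/mapP[b]|/BP[]//].
    rewrite inE => bB ->; rewrite mulf_neq0 // invr_eq0.
    by case/orP: bB => [/eqP ->|/BP[]//]; rewrite oppr_eq0 oner_neq0.
  have := uniq_leq_size CBu CBs; rewrite size_cat !size_map /= size_map.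
  rewrite -sizeNP addSn -addnS leq_add2l => lt.
  by have := leq_ltn_trans leP lt; rewrite ltnn.
have [b0 bm] := BP b bB; move/mapP: bC => [b' b'B bE].
have b'0 : b' != 0 by apply: contraNneq b0 => b'0; rewrite bE b'0 invr0 mulr0.
exists b, b'; split=> //; first by rewrite bE divfK.
by move: b'B; rewrite inE => /orP[/eqP|/BP[]]; [right | left].
Qed.

(** Single products are available away from [0] and, in the pseudo-finite case, [1]; splitting [x]
    leaves room to avoid these values. *)
Lemma sum_good_products (k : fieldType) n (u : k) :
  finite_field k \/ pseudo_finite_field k ->
  (1 < n <= 3)%N -> n%:R != 0 :> k -> ~ nth_power n u ->
  forall x : k, exists2 z, good_product n z & good_product n (x - z).
Proof.
move=> kP n3 nk nu x; have /andP[n1 _] := n3; have n0 := ltnW n1.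
case: kP => [fk|[infk _ pac _]].
  have good (z : k) : z != 0 -> good_product n z by apply: finite_good_product nu.
  have [x1|x1] := eqVneq x 1; last first.
    by exists 1; apply: good; rewrite ?oner_eq0 // subr_eq0.
  exists u; apply: good.
    by apply/eqP => u0; case: nu; exists 0; rewrite u0 expr0n gtn_eqF.
  rewrite x1 subr_eq0; apply/eqP => u1; case: nu; exists 1.
  by rewrite -u1 expr1n.
have [z] : exists z : k, z \notin [:: 0; 1; x; x - 1].
  apply: NNPP => h; case: infk; exists [:: 0; 1; x; x - 1] => z.
  by apply: contraT => zs; case: h; exists z.
rewrite !inE !negb_or => /and4P[z0 z1 zx zx1].
exists z; apply: (pac_good_product pac n3 nk nu) => //.
  by rewrite subr_eq0 eq_sym.
by rewrite subr_eq addrC -subr_eq eq_sym.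
Qed.

(** * Existence of nonsquares *)

Lemma finite_nonsquare (k : fieldType) : finite_field k -> 2%:R != 0 :> k ->
  exists u : k, ~ nth_power 2 u.
Proof.
move=> [s0 s0P] k2; pose s := undup s0; apply: NNPP => h.
have sP x : x \in s by rewrite mem_undup.
have neq : 1 != -1 :> k by rewrite -subr_eq0 opprK -(natrD _ 1 1).
(* If all elements were squares, squaring would stay onto after deleting [-1], as [(-1)^2 = 1^2];
   counting forbids this. *)
have sub : {subset s <= [seq y ^+ 2 | y <- rem (-1) s]}.
  move=> y _; apply: NNPP => ny; case: h; exists y => -[r rE]; case: ny.
  have [r1|r1] := eqVneq r (-1); apply/mapP.
    by exists 1; rewrite ?mem_rem_uniq ?undup_uniq // ?inE ?sP ?andbT // rE r1 sqrrN.
  by exists r; rewrite ?mem_rem_uniq ?undup_uniq // inE r1 sP.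
have := uniq_leq_size (undup_uniq s0) sub; rewrite size_map size_rem // -/s.
have s_gt0 : (0 < size s)%N by case: (s) (sP 0).
by rewrite leqNgt ltn_predL s_gt0.
Qed.

(** If every element were a square, the quadratic formula would put a quadratic extension inside
    [k]. *)
Lemma extension_nonsquare (k : fieldType) : unique_extension_of_degree k 2 ->
  2%:R != 0 :> k -> exists u : k, ~ nth_power 2 u.
Proof.
move=> [[L dimL] _] k2; apply: NNPP => h.
have sq (x : k) : exists y, x = y ^+ 2 by apply: NNPP => nx; apply: h; exists x.
suff LF (a : L) : a \in 1%VS.
  have : ({:L} <= 1)%VS by apply/subvP => a _.
  by move/dimvS; rewrite dimL dimv1.
pose m := minPoly 1%AS a; pose d := adjoin_degree 1%AS a.
have d2 : (d <= 2)%N.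
  have := dim_Fadjoin 1%AS a; rewrite dimv1 muln1 -/d => <-.
  by rewrite -dimL dimvS ?subvf.
have szm : size m = d.+1 := size_minPoly 1%AS a.
have mP i : m`_i \in 1%VS by have /polyOverP := minPolyOver 1%AS a.
have := minPolyxx 1%AS a; have := monic_minPoly 1%AS a.
rewrite monicE /lead_coef -/m szm /= => /eqP lc.
have d0 : (0 < d)%N by [].
rewrite horner_coef szm; case: d d2 d0 lc {szm} => [|[|[|]]] // _ _ lc.
  rewrite !big_ord_recr big_ord0 /= add0r expr0 mulr1 expr1 lc mul1r addrC.
  by move/eqP; rewrite addr_eq0 => /eqP ->; rewrite rpredN mP.
rewrite !big_ord_recr big_ord0 /= add0r expr0 mulr1 expr1 lc mul1r.
have /vlineP[q ->] := mP 0%N; have /vlineP[p ->] := mP 1%N => rel.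
(* A quarter of the discriminant of [a^2 + p a + q = 0], for completing the square. *)
have [y yE] := sq (p ^+ 2 / 4 - q).
pose i := in_alg L; have L2 : 2 != 0 :> L by rewrite -(rmorph_nat i) fmorph_eq0.
have L4 : 4 != 0 :> L by rewrite (natrM L 2 2) mulf_neq0.
have sqE : (a + i p / 2) ^+ 2 = i y ^+ 2.
  rewrite -rmorphXn -yE rmorphB fmorph_div rmorphXn rmorph_nat /=.
  have -> : q%:A = - (p%:A * a + a ^+ 2) by apply/eqP; rewrite -addr_eq0 addrA rel.
  by rewrite -[p%:A]/(i p); move: (i p) => P; field; rewrite L2 ?L4.
have i1 x : i x \in 1%VS by apply/vlineP; exists x.
have ip : i (p / 2) = i p / 2 by rewrite [LHS]fmorph_div rmorph_nat.
have -> : a = (a + i p / 2) - i (p / 2) by rewrite ip addrK.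
apply: rpredB; last exact: i1.
by move/eqP: sqE; rewrite eqf_sqr => /orP[] /eqP ->; rewrite ?rpredN i1.
Qed.

(** For [c = n] both nonconstant terms carry [n^2], and the remainder is a polynomial in [t], as
    Hensel's lemma requires. *)
Lemma expr1D_horner (R : comNzRingType) (c : R) (n : nat) :
  exists r : {poly R}, forall t,
    (1 + c * t) ^+ n = 1 + n%:R * c * t + c ^+ 2 * t ^+ 2 * r.[t].
Proof.
elim: n => [|n [r IHn]]; first by exists 0 => t; rewrite expr0 horner0; ring.
exists (r + n%:R%:P + c *: 'X * r) => t.
rewrite exprS IHn -natr1 !(hornerD, hornerM, hornerZ, hornerC, hornerX). ring.
Qed.

(** * The sets [A_n] and the defined ring *)

Section TameSets.
Variables (K : fieldType) (n : nat).

(** This is [A_n]. Multiplying [1 + 1/y] by [y^n] avoids inverses and makes [-1] a member. *)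
Definition tame_set (y : K) := ~ nonzero_power n (y ^+ n.-1 * (y + 1)).

Definition tame_sum (x : K) := exists y1 y2 y3 y4,
  [/\ tame_set y1, tame_set y2, tame_set y3, tame_set y4
    & x = y1 * y2 + y3 * y4].

(* The second clause is what rules out residue characteristic n. *)
Definition tame_ring (x : K) := tame_sum x /\
  exists2 g, tame_sum g & ~ nonzero_power n (1 + n%:R ^+ 7 * g).

End TameSets.

(** * Hensel's lemma and soundness of the definition *)

Section Valued.
Variables (K : fieldType) (v : valuation K).
Implicit Types (x y : K) (m : val_ring_type v).

Lemma notin_val_ring x : x \notin val_ring v ->
  exists2 m : val_ring_type v, m \in max_ideal v & val m * x = 1.
Proof.
rewrite inE negb_or => /andP[x0 vx].
have vx0 : 0 < v x^-1.
  have /orP[|h] := vgroup_total 0 (v x); first by rewrite (negPf vx).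
  have h0 : v x <= 0 by exact: h.
  rewrite vfunV // lt_def oppr_eq0; apply/andP; split.
    by apply: contra vx => /eqP ->.
  by have := vgroup_leD2r (- v x) h0; rewrite subrr add0r.
have Ox : x^-1 \in val_ring v by rewrite inE ltW ?orbT.
exists (ValRing Ox); last by rewrite /= mulVf.
by rewrite inE /= vx0 orbT.
Qed.

Lemma max_idealM (a m : val_ring_type v) :
  m \in max_ideal v -> a * m \in max_ideal v.
Proof.
move=> mM; have [M0 _ cl] := max_ideal_closed v.
by rewrite -[a * m]addr0 cl.
Qed.

Lemma one_notin_max_ideal : 1 \notin max_ideal v.
Proof. by have [] := max_ideal_closed v. Qed.

(** Otherwise [1/x] lies in the maximal ideal, and hence so does [1 = x^n (1/x)^n]. *)
Lemma expr_val_ring x n : (0 < n)%N -> x ^+ n \in val_ring v -> x \in val_ring v.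
Proof.
case: n => // n _ Oxn; apply: contraT => /notin_val_ring[m mM mx1].
have := max_idealM (ValRing Oxn * m ^+ n) mM.
rewrite -mulrA -exprSr; suff -> : ValRing Oxn * m ^+ n.+1 = 1.
  by rewrite (negPf one_notin_max_ideal).
by apply: val_inj; rewrite rmorphM rmorphXn /= -exprMn mulrC mx1 expr1n.
Qed.

Hypothesis v_hensel : henselian v.

(* Substituting [1 + n T] for the root makes the equation [T = m + O(T^2)]. *)
Lemma nonzero_power_1D n m : m \in max_ideal v ->
  nonzero_power n (1 + n%:R ^+ 2 * val m).
Proof.
move=> mM; split.
  have : 1 + n%:R ^+ 2 * m \notin max_ideal v.
    have /eqP n2m0 : residue (n%:R ^+ 2 * m) == 0 by rewrite residue_eq0 max_idealM.
    by rewrite -residue_eq0 rmorphD rmorph1 [X in 1 + X]n2m0 addr0 oner_eq0.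
  apply: contra => /eqP e; rewrite inE rmorphD rmorphM rmorphXn rmorph_nat rmorph1.
  by rewrite e eqxx.
have [r rE] := expr1D_horner (n%:R : val_ring_type v) n.
pose f : {poly val_ring_type v} := 'X + 'X^2 * r - m%:P.
have [||t ft0 _] := v_hensel (f := f) (a := 0).
- by rewrite !hornerE expr0n /= mul0r !add0r -mulN1r max_idealM.
- rewrite /f derivB derivD derivX derivM derivXn derivC !hornerE expr0n /=.
  by rewrite !(mul0r, mulr0, addr0, mul0rn, subr0) one_notin_max_ideal.
exists (1 + n%:R * val t).
suff : 1 + n%:R ^+ 2 * m = (1 + n%:R * t) ^+ n.
  by move=> /(congr1 val); rewrite rmorphXn !rmorphD !rmorphM !rmorph_nat rmorph1.
rewrite rE; move: ft0.
rewrite !(hornerD, hornerN, hornerM, hornerXn, hornerX, hornerC) => /eqP.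
rewrite subr_eq0 => /eqP <-.
ring.
Qed.

(** Otherwise [1/y = n^2 m] with [m] in the maximal ideal, and [1 + 1/y] is a power by
    [nonzero_power_1D]. *)
Lemma tame_set_bound n y : (0 < n)%N -> tame_set n y ->
  n%:R ^+ 2 * y \in val_ring v.
Proof.
move=> n0 Ty; apply: contraT => /notin_val_ring[m mM mny]; case: Ty.
have [nz [b bE]] := nonzero_power_1D n mM.
have y0 : y != 0.
  by apply: contraTneq (oner_neq0 K) => y0; rewrite -mny y0 !mulr0 eqxx.
have E : y ^+ n.-1 * (y + 1) = y ^+ n * (1 + n%:R ^+ 2 * val m).
  rewrite -{2}(prednK n0) exprSr -!mulrA; congr (_ * _).
  by rewrite -[X in y + X = _]mny; ring.
by rewrite E; split; [rewrite mulf_neq0 ?expf_neq0 | exists (y * b); rewrite exprMn -bE].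
Qed.


Lemma tame_ring_sound n x : (0 < n)%N -> tame_ring n x -> x \in val_ring v.
Proof.
move=> n0 [[y1 [y2 [y3 [y4 [T1 T2 T3 T4 ->]]]]]].
move=> [_ [z1 [z2 [z3 [z4 [S1 S2 S3 S4 ->]]]]] ng].
have [nM|/max_ideal_unitP[n' nn']] := boolP ((n%:R : val_ring_type v) \in max_ideal v).
  case: ng.
  have B y (Ty : tame_set n y) : exists b : val_ring_type v, val b = n%:R ^+ 2 * y.
    by exists (ValRing (tame_set_bound n0 Ty)).
  have [b1 E1] := B _ S1; have [b2 E2] := B _ S2.
  have [b3 E3] := B _ S3; have [b4 E4] := B _ S4.
  (* Of the seven factors [n], two serve [nonzero_power_1D], four make the factors of each product
     integral, and one lands in the maximal ideal. *)
  suff -> : 1 + n%:R ^+ 7 * (z1 * z2 + z3 * z4)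
      = 1 + n%:R ^+ 2 * val ((b1 * b2 + b3 * b4) * n%:R).
    exact/nonzero_power_1D/max_idealM.
  have -> : val ((b1 * b2 + b3 * b4) * n%:R)
      = (val b1 * val b2 + val b3 * val b4) * n%:R.
    by rewrite rmorphM rmorphD !rmorphM rmorph_nat.
  rewrite E1 E2 E3 E4; ring.
have tame_in y : tame_set n y -> y \in val_ring v.
  move=> /(tame_set_bound n0) ny.
  have <- : val n' ^+ 2 * (n%:R ^+ 2 * y) = y.
    move/(congr1 val): nn'; rewrite rmorphM rmorph_nat rmorph1 => nn'.
    by rewrite mulrA -exprMn [X in X ^+ 2]mulrC nn' expr1n mul1r.
  by apply: rpredM => //; apply: rpredX; exact: valP.
by rewrite rpredD ?rpredM ?tame_in.
Qed.

(** * Lifting from the residue field, and completeness *)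

Lemma residue_surj (a : residue_field v) : exists y : val_ring_type v, residue y = a.
Proof. by exists (generic_quotient.repr a); rewrite /residue reprK. Qed.

Lemma residue_unit (y : val_ring_type v) : residue y != 0 ->
  exists y' : val_ring_type v, y * y' = 1.
Proof. by rewrite residue_eq0 => /max_ideal_unitP. Qed.

(** If [y^(n-1) (y + 1) = r^n], then [(r/y)^n = 1 + 1/y] is integral, so [r/y] is integral and its
    residue is an [n]-th root of [w]. *)
Lemma tame_set_lift n (y : val_ring_type v) : (0 < n)%N ->
  moebius_nonpower n (residue y) -> tame_set n (val y).
Proof.
move=> n0 [w [nw yw]] [_ [r rE]]; case: nw.
have y0 : residue y != 0.
  by apply: contraTneq (oner_neq0 (residue_field v)) => y0; rewrite -yw y0 mul0r eqxx.
have [y' yy'] := residue_unit y0.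
have yy'K : val y * val y' = 1 by rewrite -rmorphM yy' rmorph1.
have tE : (r * val y') ^+ n = val ((y + 1) * y').
  rewrite exprMn -rE -{2}(prednK n0) exprSr mulrACA -exprMn yy'K expr1n mul1r.
  by rewrite rmorphM rmorphD rmorph1.
have Ot : r * val y' \in val_ring v by apply: (expr_val_ring n0); rewrite tE; exact: valP.
exists (residue (ValRing Ot)); rewrite -rmorphXn.
have -> : ValRing Ot ^+ n = (y + 1) * y' by apply: val_inj; rewrite rmorphXn -tE.
have yy'r : residue y * residue y' = 1 by rewrite -rmorphM yy' rmorph1.
have y'E : residue y' = w - 1 by apply: (mulfI y0); rewrite yw yy'r.
transitivity ((residue y + 1) * residue y').
  by rewrite mulrDl yy'r mul1r y'E addrC subrK.
by rewrite rmorphM rmorphD rmorph1.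
Qed.

Lemma tame_set_N1 n : tame_set n (-1 : K).
Proof. by case; rewrite addNr mulr0 eqxx. Qed.

(** Only [b2] is lifted freely, to [y2]; the other factor is [x/y2], which makes the product exact
    and has residue [b1]. *)
Lemma good_product_lift n (x : val_ring_type v) : (0 < n)%N ->
  good_product n (residue x) ->
  exists y1 y2, [/\ tame_set n y1, tame_set n y2 & val x = y1 * y2].
Proof.
move=> n0 [b1 [b2 [xE m1 m2]]].
have [y2 [y2E T2]] : exists y2 : val_ring_type v,
    residue y2 = b2 /\ tame_set n (val y2).
  case: m2 => [m2 | ->]; last first.
    exists (-1); rewrite !rmorphN !rmorph1; split=> //; exact: tame_set_N1.
  have [y2 y2E] := residue_surj b2; exists y2; split=> //.
  by apply: tame_set_lift => //; rewrite y2E.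
have b20 : residue y2 != 0.
  rewrite y2E; case: m2 => [[w [_ e]] | ->]; last by rewrite oppr_eq0 oner_eq0.
  by apply: contraTneq (oner_neq0 (residue_field v)) => b20; rewrite -e b20 mul0r eqxx.
have [y' yy'] := residue_unit b20.
have yy'r : residue y2 * residue y' = 1 by rewrite -rmorphM yy' rmorph1.
exists (val (x * y')), (val y2); split=> //; last first.
  by rewrite -rmorphM -mulrA [y' * _]mulrC yy' mulr1.
apply: tame_set_lift => //.
suff -> : residue (x * y') = b1 by [].
by rewrite rmorphM [X in X * _]xE -y2E -mulrA [X in _ * X]yy'r mulr1.
Qed.

Section Complete.
Variable n : nat.
Hypotheses (kP : finite_field (residue_field v) \/ pseudo_finite_field (residue_field v))
  (n3 : (1 < n <= 3)%N) (nk : n%:R != 0 :> residue_field v).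
Variable u : residue_field v.
Hypothesis nu : ~ nth_power n u.

Lemma tame_sum_complete x : x \in val_ring v -> tame_sum n x.
Proof.
move=> Ox; have n0 : (0 < n)%N by case/andP: n3 => /ltnW.
have [z gz gxz] := sum_good_products kP n3 nk nu (residue (ValRing Ox)).
have [y yE] := residue_surj z.
have [|y1 [y2 [T1 T2 e1]]] := @good_product_lift n y n0; first by rewrite yE.
have [|y3 [y4 [T3 T4 e2]]] := @good_product_lift n (ValRing Ox - y) n0.
  by rewrite rmorphB [X in _ - X]yE.
exists y1, y2, y3, y4; split=> //.
by rewrite -e1 -e2 rmorphB addrC subrK.
Qed.

Lemma tame_ring_complete x : x \in val_ring v -> tame_ring n x.
Proof.
move=> Ox; split; first exact: tame_sum_complete.
have n0 : (0 < n)%N by case/andP: n3 => /ltnW.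
have [w wE] := residue_surj u.
have [|n' nn'] := @residue_unit n%:R; first by rewrite rmorph_nat.
(* With [g = (w - 1)/n^7] the guard value [1 + n^7 g] is [w], a lift of the nonpower [u]. *)
have Og : val (n' ^+ 7 * (w - 1)) \in val_ring v by exact: valP.
exists (val (n' ^+ 7 * (w - 1))); first exact: tame_sum_complete.
have -> : 1 + n%:R ^+ 7 * val (n' ^+ 7 * (w - 1)) = val w.
  rewrite -(rmorph_nat (val : val_ring_type v -> K)) -rmorphXn -rmorphM.
  by rewrite mulrA -exprMn nn' expr1n mul1r rmorphB rmorph1 addrC subrK.
case=> _ [b bE]; case: nu.
have Ob : b \in val_ring v by apply: (expr_val_ring n0); rewrite -bE; exact: valP.
exists (residue (ValRing Ob)); rewrite -wE -rmorphXn; congr residue.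
by apply: val_inj; rewrite rmorphXn.
Qed.

End Complete.

End Valued.

(** * Writing the condition as an existential formula *)

Section Formula.

(** Variables 0 to 3 give the tame sum equal to [x], variables 4 to 7 the one for the witness
    [g]. *)
Definition bound_var (i : nat) : term 9 := Var (lift ord0 (inord i : 'I_8)).

Fixpoint exp_term (t : term 9) (m : nat) : term 9 :=
  if m is m'.+1 then Mul t (exp_term t m') else One 9.

Fixpoint nat_term (m : nat) : term 9 :=
  if m is m'.+1 then Add (One 9) (nat_term m') else Zero 9.

Definition power_formula (n : nat) : term 9 -> qf_formula 9 :=
  if n == 2 then @P2 9 else @P3 9.

Definition tame_formula n i : qf_formula 9 :=
  Not (power_formula n
    (Mul (exp_term (bound_var i) n.-1) (Add (bound_var i) (One 9)))).

Definition sum_term i : term 9 :=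
  Add (Mul (bound_var i) (bound_var i.+1)) (Mul (bound_var i.+2) (bound_var i.+3)).

Definition sum_formula n i : qf_formula 9 :=
  And (And (tame_formula n i) (tame_formula n i.+1))
      (And (tame_formula n i.+2) (tame_formula n i.+3)).

Definition ring_formula n : qf_formula 9 :=
  And (And (sum_formula n 0) (Eq (Var ord0) (sum_term 0)))
      (And (sum_formula n 4)
           (Not (power_formula n
             (Add (One 9) (Mul (exp_term (nat_term n) 7) (sum_term 4)))))).

Variable K : fieldType.
Implicit Types (x : K) (y : 'I_8 -> K).

Lemma eval_bound_var x y i : eval_term (env_cons x y) (bound_var i) = y (inord i).
Proof. by rewrite /= /env_cons liftK. Qed.

Lemma eval_exp_term (e : 'I_9 -> K) t m :
  eval_term e (exp_term t m) = eval_term e t ^+ m.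
Proof. by elim: m => //= m ->; rewrite exprS. Qed.

Lemma eval_nat_term (e : 'I_9 -> K) m : eval_term e (nat_term m) = m%:R.
Proof. by elim: m => //= m ->; rewrite -natr1 addrC. Qed.

Lemma holds_power_formula (e : 'I_9 -> K) n t : (1 < n <= 3)%N ->
  holds_qf e (power_formula n t) = nonzero_power n (eval_term e t).
Proof. by case: n => [|[|[|[|]]]]. Qed.

Lemma holds_tame_formula n x y i : (1 < n <= 3)%N ->
  holds_qf (env_cons x y) (tame_formula n i) = tame_set n (y (inord i)).
Proof.
move=> n3; pose t := Mul (exp_term (bound_var i) n.-1) (Add (bound_var i) (One 9)).
have tE : eval_term (env_cons x y) t = y (inord i) ^+ n.-1 * (y (inord i) + 1).
  by rewrite -!(eval_bound_var x) -eval_exp_term.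
by rewrite /tame_set -tE -holds_power_formula.
Qed.

Lemma holds_ring_formula n x : (1 < n <= 3)%N ->
  (exists y, holds_qf (env_cons x y) (ring_formula n)) <-> tame_ring n x.
Proof.
move=> n3.
have sumE y i : eval_term (env_cons x y) (sum_term i)
    = y (inord i) * y (inord i.+1) + y (inord i.+2) * y (inord i.+3).
  by rewrite -!(eval_bound_var x).
have xsumE y : (x = y (inord 0) * y (inord 1) + y (inord 2) * y (inord 3))
    = (eval_term (env_cons x y) (Var ord0) = eval_term (env_cons x y) (sum_term 0)).
  by rewrite sumE /= /env_cons unlift_none.
have guardE y : eval_term (env_cons x y)
    (Add (One 9) (Mul (exp_term (nat_term n) 7) (sum_term 4)))
    = 1 + n%:R ^+ 7 * eval_term (env_cons x y) (sum_term 4).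
  by rewrite -(eval_nat_term (env_cons x y)) -eval_exp_term.
have formE y : holds_qf (env_cons x y) (ring_formula n) =
    ((((tame_set n (y (inord 0)) /\ tame_set n (y (inord 1))) /\
       (tame_set n (y (inord 2)) /\ tame_set n (y (inord 3)))) /\
      x = y (inord 0) * y (inord 1) + y (inord 2) * y (inord 3)) /\
     (((tame_set n (y (inord 4)) /\ tame_set n (y (inord 5))) /\
       (tame_set n (y (inord 6)) /\ tame_set n (y (inord 7)))) /\
      ~ nonzero_power n (1 + n%:R ^+ 7 *
          (y (inord 4) * y (inord 5) + y (inord 6) * y (inord 7))))).
  by rewrite xsumE -!(holds_tame_formula x) // -sumE -guardE -holds_power_formula.
split=> [[y]|].
  rewrite formE => -[[[[T0 T1] [T2 T3]] xE] [[[T4 T5] [T6 T7]] ng]]; split.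
    by exists (y (inord 0)), (y (inord 1)), (y (inord 2)), (y (inord 3)).
  exists (y (inord 4) * y (inord 5) + y (inord 6) * y (inord 7)) => //.
  by exists (y (inord 4)), (y (inord 5)), (y (inord 6)), (y (inord 7)).
move=> [[y0 [y1 [y2 [y3 [T0 T1 T2 T3 xE]]]]] [_ [y4 [y5 [y6 [y7 [T4 T5 T6 T7 ->]]]]] ng]].
exists (fun i : 'I_8 => [:: y0; y1; y2; y3; y4; y5; y6; y7]`_i).
by rewrite formE !inordK.
Qed.

End Formula.

Theorem theorem1p1 :
  exists phi : ex_formula1,
    forall (K : fieldType) (v : valuation K),
      nontrivial_valuation v ->
      henselian v ->
      finite_field (residue_field v) \/ pseudo_finite_field (residue_field v) ->
      (2%N \in [pchar (residue_field v)] ->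
         exists a : residue_field v, ~ exists b : residue_field v, a = b ^+ 3) ->
      forall x : K, x \in val_ring v <-> holds phi x.
Proof.
exists (@ExFormula1 8 (Or (ring_formula 2) (ring_formula 3))) => K v _ v_hensel kP k3 x.
split=> [Ox|[y] [h|h]]; last 2 first.
- apply: (tame_ring_sound v_hensel (n := 2)) => //.
  by apply/holds_ring_formula => //; exists y.
- apply: (tame_ring_sound v_hensel (n := 3)) => //.
  by apply/holds_ring_formula => //; exists y.
(* In residue characteristic 2 the exponent 3 works, with the given noncube; otherwise 2 works, as
   nonsquares exist. *)
have [k2|k2] := boolP (2 == 0 :> residue_field v).
  have ch2 : 2%N \in [pchar (residue_field v)] by rewrite inE.
  have [u nu] := k3 ch2.
  have k30 : 3 != 0 :> residue_field v.
    by rewrite -(natr1 2) (eqP k2) add0r oner_neq0.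
  have := tame_ring_complete kP (n := 3) isT k30 nu Ox.
  by move/holds_ring_formula => -[//|y h]; exists y; right.
have [u nu] : exists u : residue_field v, ~ nth_power 2 u.
  case: kP => [fk | [_ _ _ /(_ 2 isT) uk]]; first exact: finite_nonsquare.
  exact: extension_nonsquare.
have := tame_ring_complete kP (n := 2) isT k2 nu Ox.
by move/holds_ring_formula => -[//|y h]; exists y; left.
Qed.
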